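(* Let $X$ be a locally compact Hausdorff space, let $A$ be a $C^{*}$-algebra, and let $f\in C^{b}(X,A)$. Then $f$ belongs to $C^{b}(X)\otimes A$ (viewed as a subalgebra of $C^{b}(X,A)$) if and only if the range $R(f):=\{f(x):x\in X\}$ is a precompact subset of $A$.
   Context: $C^{b}(X,A)$ denotes the $C^{*}$-algebra of all bounded continuous functions $X\to A$ (with $A$ carrying its norm topology), with pointwise operations and the supremum norm; $C^{b}(X):=C^{b}(X,\mathbb{C})$. Elements of the algebraic tensor product $C^{b}(X)\odot A$ are viewed as functions in $C^{b}(X,A)$ via $(\sum_i f_i\otimes a_i)(x)=\sum_i f_i(x)a_i$. The supremum norm restricts to a $C^{*}$-norm on $C^{b}(X)\odot A$, and $C^{b}(X)\otimes A$ denotes the completion, identified with the norm closure of $C^{b}(X)\odot A$ in $C^{b}(X,A)$. A subset of a topological space is called precompact if its closure is compact. *)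

(* Defs.v *)
(* The complex numbers are R[i], for R : realType. *)
From HB Require Import structures.
From mathcomp Require Import all_boot all_order all_algebra.
From mathcomp Require Import all_classical all_reals all_analysis.
From mathcomp Require Import complex.

Set Implicit Arguments.
Unset Strict Implicit.
Unset Printing Implicit Defensive.
Import Order.TTheory GRing.Theory Num.Theory.
Import numFieldNormedType.Exports.
Local Open Scope classical_set_scope.
Local Open Scope ring_scope.
Local Open Scope complex_scope.

(* C*-algebras are not assumed unital (nor nonzero), hence the multiplication is
   not taken from MathComp's ring hierarchy. *)
HB.mixin Record CompleteNormedModule_isCstarAlgebra (R : realType) A
    & @CompleteNormedModule R[i] A := {
  cmul : A -> A -> A ;
  cstar : A -> A ;
  cmulA : associative cmul ;
  cmulDl : left_distributive cmul +%R ;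
  cmulDr : right_distributive cmul +%R ;
  cmulZl : forall (k : R[i]) (a b : A), cmul (k *: a) b = k *: cmul a b ;
  cmulZr : forall (k : R[i]) (a b : A), cmul a (k *: b) = k *: cmul a b ;
  cstarK : involutive cstar ;
  cstarD : {morph cstar : a b / a + b} ;
  cstarZ : forall (k : R[i]) (a : A), cstar (k *: a) = k^* *: cstar a ;
  cstarM : forall a b : A, cstar (cmul a b) = cmul (cstar b) (cstar a) ;
  cnormM : forall a b : A, `|cmul a b| <= `|a| * `|b| ;
  cnorm_star : forall a : A, `|cmul (cstar a) a| = `|a| ^+ 2
}.

#[short(type="cstarAlgType")]
HB.structure Definition CstarAlgebra (R : realType) :=
  { A of @CompleteNormedModule R[i] A
       & CompleteNormedModule_isCstarAlgebra R A }.

Section BoundedContinuous.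
Variables (R : realType) (X : topologicalType) (V : normedModType R[i]).
Implicit Types f g : X -> V.

Definition bcont : {pred X -> V} :=
  mem [set f | continuous f /\ bounded_fun f].

Lemma bcont_submod_closed : submod_closed bcont.
Proof.
split; first by rewrite inE; split; [exact: cst_continuous|exact: bounded_cst].
move=> k f g; rewrite !inE => -[cf bf] [cg bg]; split.
  by move=> x; apply: cvgD; [apply: cvgZl_tmp; exact: cf|exact: cg].
have [M M0 fM] := ex_strict_bound_gt0 bf.
have [N N0 gN] := ex_strict_bound_gt0 bg.
exists (`|k| * M + N); split=> [|B /ltW kMN x _ /=].
  by rewrite ger0_real// addr_ge0 ?mulr_ge0// ltW.
rewrite (le_trans _ kMN)// (le_trans (ler_normD _ _))// lerD//; last exact/ltW/gN.
by rewrite normrZ ler_wpM2l//; exact/ltW/fM.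
Qed.

HB.instance Definition _ :=
  GRing.isSubmodClosed.Build _ _ bcont bcont_submod_closed.

(* C^b(X, V); C^b(X) is Cb X R[i]^o *)
Record Cb := MkCb { Cb_fun :> X -> V; _ : Cb_fun \in bcont }.

HB.instance Definition _ := [isSub for Cb_fun].
HB.instance Definition _ := [Choice of Cb by <:].
HB.instance Definition _ := [SubChoice_isSubLmodule of Cb by <:].

Lemma Cb_continuous (f : Cb) : continuous f.
Proof. by have := valP f; rewrite inE => -[]. Qed.

Lemma Cb_bounded (f : Cb) : bounded_fun f.
Proof. by have := valP f; rewrite inE => -[]. Qed.

(* Norms are R[i]-valued (with zero imaginary part), suprema live in R. *)
Definition sup_norm f : R := sup (range (fun x => complex.Re `|f x|)).

Let ReK (v : V) : (complex.Re `|v|)%:C = `|v|.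
Proof. by rewrite RRe_real// ger0_real. Qed.

Let Re_ge0 (v : V) : 0 <= complex.Re `|v|.
Proof. by rewrite -ler0c ReK. Qed.

Lemma Cb_has_ubound (f : Cb) :
  has_ubound (range (fun x => complex.Re `|f x|)).
Proof.
have [M M0 fM] := ex_strict_bound_gt0 (Cb_bounded f).
exists (complex.Re M) => _ [x _ <-].
by rewrite -lecR ReK RRe_real ?gtr0_real//; exact/ltW/fM.
Qed.

Lemma le_sup_norm (f : Cb) (x : X) : `|f x| <= (sup_norm f)%:C.
Proof.
rewrite -ReK lecR; apply: ub_le_sup; first exact: Cb_has_ubound.
by exists x.
Qed.

Let sup_norm0 f : ~ inhabited X -> sup_norm f = 0.
Proof.
move=> X0; have r0 : range (fun x => complex.Re `|f x|) = set0.
  by rewrite -subset0 => y [x _ _]; exact: (X0 (inhabits x)).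
by rewrite /sup_norm r0 sup0.
Qed.

Lemma sup_norm_le f (c : R) :
  0 <= c -> (forall x, `|f x| <= c%:C) -> sup_norm f <= c.
Proof.
move=> c0 fc; have [[x0]|X0] := pselect (inhabited X).
  apply: ge_sup; first by exists (complex.Re `|f x0|), x0.
  by move=> _ [x _ <-]; rewrite -lecR ReK.
by rewrite sup_norm0.
Qed.

Lemma sup_norm_ge0 (f : Cb) : 0 <= sup_norm f.
Proof.
have [[x]|X0] := pselect (inhabited X).
  by rewrite -ler0c; exact: le_trans (le_sup_norm f x).
by rewrite sup_norm0.
Qed.

Let Cb_norm (f : Cb) : R[i] := (sup_norm f)%:C.

Let Cb_normD (f g : Cb) : Cb_norm (f + g) <= Cb_norm f + Cb_norm g.
Proof.
rewrite /Cb_norm -rmorphD/= lecR; apply: sup_norm_le.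
  by rewrite addr_ge0// sup_norm_ge0.
by move=> x; rewrite rmorphD/= (le_trans (ler_normD _ _))// lerD// le_sup_norm.
Qed.

Let Cb_normZ (k : R[i]) (f : Cb) : Cb_norm (k *: f) = `|k| * Cb_norm f.
Proof.
have leZ l (g : Cb) : Cb_norm (l *: g) <= `|l| * Cb_norm g.
  have lE : (complex.Re `|l|)%:C = `|l| by rewrite RRe_real// ger0_real.
  rewrite -lE /Cb_norm -rmorphM/= lecR; apply: sup_norm_le.
    by rewrite mulr_ge0// ?sup_norm_ge0// -ler0c lE.
  move=> x; rewrite rmorphM/= lE.
  by rewrite (_ : `|_| = `|l| * `|g x|) ?ler_wpM2l ?le_sup_norm// -normrZ.
apply/eqP; rewrite eq_le leZ/=.
have [->|k0] := eqVneq k 0.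
  by rewrite normr0 mul0r /Cb_norm ler0c sup_norm_ge0.
rewrite -ler_pdivlMl ?normr_gt0// -normfV (le_trans _ (leZ _ _))//.
by rewrite scalerA mulVf// scale1r.
Qed.

Let Cb_norm0_eq0 (f : Cb) : Cb_norm f = 0 -> f = 0.
Proof.
move=> f0; apply/val_inj/funext => x /=; apply/eqP.
by rewrite -normr_le0 -[leRHS]f0 le_sup_norm.
Qed.

HB.instance Definition _ :=
  Lmodule_isNormed.Build R[i] Cb Cb_normD Cb_normZ Cb_norm0_eq0.

Lemma Cb_normE (f : Cb) : `|f| = (sup_norm f)%:C.
Proof. by []. Qed.

End BoundedContinuous.

Section TensorProduct.
Variables (R : realType) (X : topologicalType) (A : cstarAlgType R).

(* image of the algebraic tensor product of C^b(X) and A in C^b(X, A) *)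
Definition Cb_odot : set (Cb X A) :=
  [set g | exists (n : nat) (h : 'I_n -> Cb X R[i]^o) (a : 'I_n -> A),
     forall x : X, g x = \sum_(i < n) (h i x : R[i]) *: a i].

(* C^b(X) (x) A, as a subset of C^b(X, A); the closure is for the sup norm *)
Definition Cb_otimes : set (Cb X A) := closure Cb_odot.

End TensorProduct.
Arguments Cb_odot {R} X A.
Arguments Cb_otimes {R} X A.

(* Main.v *)
(* If f is a uniform limit of elements of C^b(X) (.) A, its range is, for each e,
   within e of a compact set, namely the image of a compact polydisc under
   c |-> \sum_i c_i a_i; completeness of A then makes the closure compact.
   Conversely, cover the closure of the range by finitely many balls of radius e
   and centres a_i: a partition of unity h_i on X, with h_i supported where
   |f - a_i| < e, gives |f - \sum_i h_i a_i| <= e. *)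
Require Import Defs.
From mathcomp Require Import all_boot all_order all_algebra finmap.
From mathcomp Require Import all_classical all_reals all_analysis.
From mathcomp Require Import complex.
Local Open Scope classical_set_scope.

Set Implicit Arguments.
Unset Strict Implicit.
Unset Printing Implicit Defensive.
Import Order.TTheory GRing.Theory Num.Theory.
Import numFieldNormedType.Exports.
Local Open Scope ring_scope.
Local Open Scope complex_scope.

(** An ultrafilter [F] on [closure S] is Cauchy: moving each point to a nearby point of a compact
    [C] sends [F] to a filter clustering at some [c] in [C], and the ball of radius [e] about [c]
    then belongs to [F]. Completeness gives the limit. *)
Lemma compact_closure_approx (K : numFieldType)
    (T : completePseudoMetricType K) (S : set T) :
  (forall e : K, 0 < e ->
    exists2 C, compact C & S `<=` \bigcup_(c in C) ball c e) ->
  compact (closure S).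
Proof.
move=> SC; rewrite compact_ultra => F UF FS.
suff /cauchy_cvgP/cvg_ex[p Fp] : cauchy F.
  by exists p; split=> //; exact: (closed_cvg _ (@closed_closure _ S) (u_ := id) FS _ Fp).
apply: cauchy_exP => e e0.
(* One quarter of [e] leads from the closure to [S], another from [S] to [C]. *)
have e4 : 0 < e / 2 / 2 by rewrite !divr_gt0.
have [C cptC SCe] := SC _ e4.
have pP y : exists c, closure S y -> C c /\ ball c (e / 2) y.
  have [Sy|nSy] := pselect (closure S y); last by exists y.
  have [z [/SCe[c Cc cz] yz]] := Sy _ (nbhsx_ballx y _ e4).
  by exists c => _; split=> //; exact: ball_splitl cz yz.
have [p {}pP] := choice pP.
have [c [Cc clc]] : C `&` cluster (p @ F) !=set0.
  by apply: cptC; exact: filterS (fun y Sy => (pP y Sy).1) FS.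
(* If [F] contained the complement of the ball, some [y] outside it would have [p y] within [e / 2]
   of both [c] and [y]. *)
exists c; have [//|Fn] := in_ultra_setVsetC (ball c e) UF.
have e2 : 0 < e / 2 by rewrite divr_gt0.
have [z [[y [nby Sy] <-] cz]] :
    p @` (~` ball c e `&` closure S) `&` ball c (e / 2) !=set0.
  apply: clc (nbhsx_ballx c _ e2).
  by apply: (@filterS _ F _ _ _ _ (filterI Fn FS)) => y ?; exists y.
by exfalso; apply: nby; apply: ball_split cz _; have [] := pP _ Sy.
Qed.

Lemma real_complex_continuous (R : realType) :
  continuous (real_complex R : R -> R[i]^o).
Proof.
move=> x; apply/cvgrPdist_lt => e e0.
have eE : (complex.Re e)%:C = e by rewrite RRe_real// gtr0_real.
have re0 : 0 < complex.Re e by rewrite -ltcR eE.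
near=> y; rewrite -rmorphB/= normc_def/= expr0n addr0 sqrtr_sqr -eE ltcR.
near: y; exact: cvgr_dist_lt.
Unshelve. all: by end_near. Qed.

(** The disc lies in a closed square, as |Re z| and |Im z| are at most |z|. *)
Lemma disc_subset_compact (R : realType) (M : R) :
  exists2 D : set R[i]^o, compact D & forall z : R[i], `|z| <= M%:C -> D z.
Proof.
pose g (p : R * R) : R[i]^o := p.1%:C + 'i *: (p.2%:C : R[i]^o).
exists (g @` (`[- M, M] `*` `[- M, M])).
  apply: continuous_compact;
    last by apply: compact_setX; exact: segment_compact.
  apply: continuous_subspaceT => p; apply: cvgD.
    apply: (@continuous_comp _ _ _ fst (real_complex R : R -> R[i]^o)).
      exact: cvg_fst.
    exact: real_complex_continuous.
  apply: (@cvgZl_tmp R[i] R[i]^o _ _ _ 'i (fun p => p.2%:C)).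
  apply: (@continuous_comp _ _ _ snd (real_complex R : R -> R[i]^o)).
    exact: cvg_snd.
  exact: real_complex_continuous.
move=> z zM; exists (complex.Re z, complex.Im z); last first.
  by rewrite /g/=; case: z {zM} => a b; simpc.
move: zM; rewrite normc_def lecR => zM.
split=> /=; rewrite in_itv/= -ler_norml (le_trans _ zM)//;
  rewrite -sqrtr_sqr ler_sqrt ?addr_ge0 ?sqr_ge0//.
  by rewrite lerDl sqr_ge0.
by rewrite lerDr sqr_ge0.
Qed.

(** Induction on [n]: the last coefficient ranges over a compact [D], and the continuous image of
    [C] times [D] is compact. *)
Lemma polydisc_subset_compact (R : realType) (V : normedModType R[i]) (n : nat)
    (a : 'I_n -> V) (M : 'I_n -> R) :
  exists2 C : set V, compact C &
    forall c : 'I_n -> R[i], (forall i, `|c i| <= (M i)%:C) ->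
      C (\sum_(i < n) c i *: a i).
Proof.
elim: n a M => [|n IH] a M.
  exists [set 0]; first exact: compact_set1.
  by move=> c _; rewrite big_ord0.
pose w := widen_ord (leqnSn n).
have [C cptC Cc] := IH (a \o w) (M \o w).
have [D cptD Dd] := disc_subset_compact (M ord_max).
pose g (p : V * R[i]^o) : V := p.1 + (p.2 : R[i]) *: a ord_max.
exists (g @` (C `*` D)).
  apply: continuous_compact; last exact: compact_setX.
  apply: continuous_subspaceT => p; apply: cvgD; first exact: cvg_fst.
  by apply: cvgZr_tmp; exact: cvg_snd.
move=> c cM; rewrite big_ord_recr/=.
exists (\sum_(i < n) c (w i) *: a (w i), c ord_max) => //.
by split=> /=; [apply: Cc|apply: Dd].
Qed.

Lemma Cb_odot_approx (R : realType) (X : topologicalType) (A : cstarAlgType R)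
    (f : Cb X A) (e : R[i]) :
  0 < e -> compact (closure (range f)) ->
  exists2 g, Cb_odot X A g & forall x, `|f x - g x| <= e.
Proof.
move=> e0; rewrite compact_cover => cptf.
have [||D _ fD] := cptf _ setT (fun a : A => ball a e).
- by move=> a _; exact: ball_open.
- by move=> a _; exists a => //; exact: ballxx.
pose n := size D; pose a (i : 'I_n) := nth 0 D i.
(* twice the positive part of [e - `|f x - a i|] *)
pose w (i : 'I_n) (x : X) : R[i] := `|e - `|f x - a i| | + (e - `|f x - a i|).
(* The order on [R[i]] is partial, so sign arguments need this number to be real. *)
have w_real i x : e - `|f x - a i| \is Num.real.
  by apply: rpredB; [exact: gtr0_real|exact: normr_real].
have w_ge0 i x : 0 <= w i x.
  by rewrite /w -lerBlDr sub0r -[leRHS]normrN real_ler_norm// rpredN.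
pose s x := \sum_(i < n) w i x.
have s_gt0 x : 0 < s x.
  have [b /= Db bfx] : cover [set` D] (fun a : A => ball a e) (f x).
    by apply: fD; apply: subset_closure; exists x.
  move: bfx; rewrite -ball_normE/= => bfx.
  (* The centre [b] of a ball containing [f x] contributes a strictly positive term to [s x]. *)
  have bn : (index b D < n)%N by rewrite index_mem.
  rewrite /s (bigD1 (Ordinal bn))//= ltr_pwDl ?sumr_ge0//.
  have d0 : 0 < e - `|f x - a (Ordinal bn)|.
    by rewrite /a/= nth_index// subr_gt0 distrC.
  by rewrite /w ltr_wpDl.
have s_neq0 x : s x != 0 by rewrite lt0r_neq0.
have cw i : continuous (w i : X -> R[i]^o).
  have cd : continuous ((fun x => e - `|f x - a i|) : X -> R[i]^o).
    move=> x; apply: cvgB; first exact: cvg_cst.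
    apply: cvg_norm; apply: cvgB; last exact: cvg_cst.
    exact: Cb_continuous.
  by move=> x; apply: cvgD; [apply: (@cvg_norm _ R[i]^o); exact: cd|exact: cd].
have cs : continuous (s : X -> R[i]^o).
  by apply: continuous_big => //; exact: add_continuous.
pose h i x : R[i]^o := w i x / s x.
have h_ge0 i x : 0 <= h i x by rewrite divr_ge0// ltW.
have sumh x : \sum_(i < n) h i x = 1.
  by rewrite /h -mulr_suml divff// s_neq0.
have hb i : h i \in @bcont R X R[i]^o.
  rewrite inE; split.
    move=> x; apply: cvgM; first exact: cw.
    by apply: cvgV; [exact: s_neq0|exact: cs].
  exists 1; split=> // M /ltW M1 x _ /=; rewrite (le_trans _ M1)//.
  rewrite ger0_norm// -(sumh x) (bigD1 i)//= lerDl sumr_ge0//.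
pose g x := \sum_(i < n) (h i x : R[i]) *: a i.
have fg x : `|f x - g x| <= e.
  (* Since the [h i x] sum to 1, both [f x] and [e] become weighted sums, compared term by term:
     either |f x - a i| <= e or [h i x] vanishes. *)
  rewrite -[f x]scale1r -(sumh x) scaler_suml -sumrB.
  rewrite (le_trans (ler_norm_sum _ _ _))// -[leRHS]mul1r -(sumh x) mulr_suml.
  apply: ler_sum => i _; rewrite -scalerBr normrZ ger0_norm//.
  have [le_e|/ltW e_le] := real_leP (normr_real (f x - a i)) (gtr0_real e0).
    by rewrite ler_wpM2l.
  by rewrite /h /w ler0_norm ?subr_le0// addNr !mul0r.
have gb : g \in @bcont R X A.
  rewrite inE; split.
    apply: continuous_big => [|i _ x]; first exact: add_continuous.
    apply: cvgZr_tmp.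
    by have := hb i; rewrite inE => -[+ _]; exact.
  have [M M0 fM] := ex_strict_bound_gt0 (Cb_bounded f).
  (* From |g| <= |f| + |f - g|. *)
  exists (M + e); split=> [|B /ltW MB x _ /=]; first by rewrite gtr0_real// addr_gt0.
  rewrite (le_trans _ MB)// -[g x](subKr (f x)) (le_trans (ler_normB _ _))// lerD//.
  exact/ltW/fM.
exists (MkCb gb); last exact: fg.
by exists n, (fun i => MkCb (hb i)), a.
Qed.

Theorem theorem1 (R : realType) (X : topologicalType) (A : cstarAlgType R)
    (hX : hausdorff_space X) (lcX : locally_compact [set: X]) (f : Cb X A) :
  Cb_otimes X A f <-> compact (closure (range f)).
Proof.
split=> [fA|cptf].
  apply: compact_closure_approx => e e0.
  have [g [[n [h [a gE]]] fg]] := fA _ (nbhsx_ballx f _ e0).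
  (* The sup norms of the [h i] are radii valid for all [x] at once. *)
  have [C cptC CM] := polydisc_subset_compact a (fun i => sup_norm (h i)).
  exists C => // _ [x _ <-]; exists (g x).
    by rewrite gE; apply: CM => i; exact: (@le_sup_norm _ _ R[i]^o).
  move: fg; rewrite -!ball_normE/= distrC.
  by apply: le_lt_trans; exact: (le_sup_norm (g - f)).
move=> B /nbhs_ballP[e/= e0 eB].
(* Halving turns the non-strict bound of the approximation into the strict one required by the open
   ball. *)
have e2 : 0 < e / 2 by rewrite divr_gt0.
have [g gA fg] := Cb_odot_approx e2 cptf.
exists g; split=> //; apply: eB; rewrite -ball_normE/=.
have eE : (complex.Re (e / 2))%:C = e / 2 by rewrite RRe_real// gtr0_real.
apply: (@le_lt_trans _ _ (e / 2)); last by rewrite ltr_pdivrMr// ltr_pMr// ltr1n.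
rewrite Cb_normE -eE lecR; apply: sup_norm_le => [|x]; first by rewrite -lecR eE ltW.
by rewrite eE; exact: fg.
Qed.
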